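(* Let $f:\subseteq\mathcal C(\subseteq\mathbb N^{\mathbb N},\mathbb N^{\mathbb N})\times\mathbb N^{\mathbb N}\to\mathbb N^{\mathbb N}$ be a computable (partial) function. Then there is a total computable injection $R:\mathbb N^{\mathbb N}\to\mathbb N^{\mathbb N}$ such that \[\mathsf U_{R(q)}(p)=f(R,\langle q,p\rangle)\] for all $q,p\in\mathbb N^{\mathbb N}$ such that $f(R,\langle q,p\rangle)$ is defined.
   Context: A partial function $F:\subseteq\mathbb N^{\mathbb N}\to\mathbb N^{\mathbb N}$ is computable if there is a computable monotone (w.r.t. the prefix order) word function $\varphi:\mathbb N^*\to\mathbb N^*$ with $F(p)=\sup_{w\sqsubseteq p}\varphi(w)$ for all $p\in\mathrm{dom}(F)$; $F$ is continuous iff the same holds with an arbitrary monotone $\varphi$. $\mathcal C(\subseteq\mathbb N^{\mathbb N},\mathbb N^{\mathbb N})$ is the set of partial continuous functions $\subseteq\mathbb N^{\mathbb N}\to\mathbb N^{\mathbb N}$ (with natural domains) that is represented by a fixed standard total representation $\Phi$, where a name $q\in\mathbb N^{\mathbb N}$ encodes the graph of a monotone word function approximating $\Phi_q$. Write $\mathsf U_q:=\Phi_q$. With $\langle q,p\rangle:=q(0)p(0)q(1)p(1)\dots$, the universal function $\mathsf U\langle q,p\rangle:=\mathsf U_q(p)$ is a computable partial function, and the smn-theorem holds: for every computable (continuous) $F:\subseteq\mathbb N^{\mathbb N}\to\mathbb N^{\mathbb N}$ there is a total computable (continuous) $S:\mathbb N^{\mathbb N}\to\mathbb N^{\mathbb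 N}$ with $\mathsf U_{S(q)}(p)=F\langle q,p\rangle$ for all $\langle q,p\rangle\in\mathrm{dom}(F)$. Without loss of generality the names allow the digits $0,1,2$ as dummy symbols: adding or removing these digits in a name $q$ does not change $\mathsf U_q$. Computability of $f$ is understood with respect to the representation $\Phi$: there is a computable $F:\subseteq\mathbb N^{\mathbb N}\to\mathbb N^{\mathbb N}$ with $F\langle s,r\rangle=f(\mathsf U_s,r)$ for all $s,r\in\mathbb N^{\mathbb N}$ with $(\mathsf U_s,r)\in\mathrm{dom}(f)$. A function $F:\subseteq\mathbb N^{\mathbb N}\to\mathbb N^{\mathbb N}$ is a computable injection if it is computable and injective and there is a computable $G:\subseteq\mathbb N^{\mathbb N}\to\mathbb N^{\mathbb N}$ with $G\circ F(p)=p$ for all $p\in\mathrm{dom}(F)$. *)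

(* Defs.v *)
From mathcomp Require Import all_boot boolp.

Set Implicit Arguments.
Unset Strict Implicit.
Unset Printing Implicit Defensive.

(* Partial recursive functions: terms indexed by arity.  [rec_prim] recurses
   on its first argument and [rec_min] minimizes over its first argument. *)
Inductive partrec : nat -> Type :=
| rec_zero : partrec 0
| rec_succ : partrec 1
| rec_proj n (i : 'I_n) : partrec n
| rec_comp k n (g : partrec k) (h : 'I_k -> partrec n) : partrec n
| rec_prim n (g : partrec n) (h : partrec n.+2) : partrec n.+1
| rec_min n (g : partrec n.+1) : partrec n.

(* [rec_graph c v y]: the computation of [c] on [v] converges to [y]. *)
Fixpoint rec_graph n (c : partrec n) : n.-tuple nat -> nat -> Prop :=
  match c with
  | rec_zero => fun _ y => y = 0
  | rec_succ => fun v y => y = (thead v).+1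
  | rec_proj _ i => fun v y => y = tnth v i
  | rec_comp k _ g h => fun v y =>
      exists2 u : k.-tuple nat,
        (forall i, rec_graph (h i) v (tnth u i)) & rec_graph g u y
  | rec_prim _ g h => fun v y =>
      let w := behead_tuple v in
      (fix iter_graph x y := match x with
         | 0 => rec_graph g w y
         | x'.+1 => exists2 z, iter_graph x' z
                             & rec_graph h (cons_tuple x' (cons_tuple z w)) y
         end) (thead v) y
  | rec_min _ g => fun v y =>
      rec_graph g (cons_tuple y v) 0 /\
      forall x, x < y -> exists z, rec_graph g (cons_tuple x v) z.+1
  end.

Definition word := seq nat.
Definition baire := nat -> nat.
Definition pfun (A B : Type) := A -> option B.

Definition dom A B (F : pfun A B) (x : A) : Prop := exists y, F x = Some y.
Definition total_pfun A B (F : A -> B) : pfun A B := fun x => Some (F x).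

Definition initial (w : word) (p : baire) : Prop := w = mkseq p (size w).

Definition monotone (phi : word -> word) : Prop :=
  forall u v, prefix u v -> prefix (phi u) (phi v).

(* [CodeSeq.code] is MathComp's bijection between [seq nat] and [nat]. *)
Definition computable_word (phi : word -> word) : Prop :=
  exists c : partrec 1,
    forall w, rec_graph c [tuple CodeSeq.code w] (CodeSeq.code (phi w)).

(* The infinite sequence [y] is the supremum, in the prefix order, of the
   words [phi w] for [w] an initial segment of [p]. *)
Definition is_sup (phi : word -> word) (p y : baire) : Prop :=
  (forall w, initial w p -> initial (phi w) y) /\
  (forall m, exists2 w, initial w p & m <= size (phi w)).

Definition computable (F : pfun baire baire) : Prop :=
  exists phi, [/\ computable_word phi, monotone phi &
    forall p y, F p = Some y -> is_sup phi p y].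

(* Continuous partial functions with natural domain: the domain consists of
   all points at which the approximating word function has infinite supremum. *)
Definition natural_continuous (F : pfun baire baire) : Prop :=
  exists2 phi, monotone phi & forall p y, F p = Some y <-> is_sup phi p y.

Definition cfun := {F : pfun baire baire | natural_continuous F}.

Definition interleave (q p : baire) : baire :=
  fun n => if odd n then p n./2 else q n./2.

(* A name lists pairs of words: the digits 0, 1, 2 are dummies, and every other
   digit codes a pair [(u, v)] (some code no pair and are ignored as well). *)
Definition pair_digit (u v : word) : nat :=
  (CodeSeq.code [:: CodeSeq.code u; CodeSeq.code v]).+3.

Definition lists (q : baire) (u v : word) : Prop :=
  exists i, q i = pair_digit u v.

(* If [q] lists the graph of a monotone word function [phi], then [names q p y]
   is [is_sup phi p y], see [lists_graph_names].  For an arbitrary [q] the listed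
   pairs need not be consistent along [p]; then no [y] satisfies [names q p y]. *)
Definition names (q p y : baire) : Prop :=
  (forall u v, lists q u v -> initial u p -> initial v y) /\
  (forall m, exists u v, [/\ lists q u v, initial u p & m <= size v]).

Definition Phi_fun (q : baire) : pfun baire baire := fun p =>
  if pselect (exists y, names q p y) is left ex then Some (sval (cid ex))
  else None.

Lemma initial_mkseq p n : initial (mkseq p n) p.
Proof. by rewrite /initial size_mkseq. Qed.

Lemma nth_initial w p i : initial w p -> i < size w -> nth 0 w i = p i.
Proof. by move=> -> ; rewrite size_mkseq => lt_i; rewrite nth_mkseq. Qed.

Lemma mkseq_prefix (p : baire) m n : m <= n -> prefix (mkseq p m) (mkseq p n).
Proof.
move=> le_mn; rewrite /mkseq -(subnKC le_mn) iotaD map_cat.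
exact: prefix_prefix.
Qed.

Lemma take_mkseq (p : baire) m n : m <= n -> take m (mkseq p n) = mkseq p m.
Proof.
move=> /(mkseq_prefix p); rewrite prefixE size_mkseq => /eqP; exact.
Qed.

Lemma initial_prefix (u v : word) p : prefix u v -> initial v p -> initial u p.
Proof.
move=> uv pv; have le_uv := size_prefix uv; move: uv.
by rewrite prefixE pv take_mkseq // => /eqP.
Qed.

Lemma initial_comparable (u v : word) p :
  initial u p -> initial v p -> size u <= size v -> prefix u v.
Proof. by move=> -> ->; rewrite !size_mkseq; apply: mkseq_prefix. Qed.

Lemma prefix_comparable (u v w : word) :
  prefix u w -> prefix v w -> size u <= size v -> prefix u v.
Proof.
rewrite !prefixE => /eqP Eu /eqP Ev le_uv.
by rewrite -Ev take_takel // Eu.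
Qed.

Lemma pair_digit_inj u v u' v' :
  pair_digit u v = pair_digit u' v' -> u = u' /\ v = v'.
Proof.
have code_inj := can_inj CodeSeq.codeK.
move=> /succn_inj/succn_inj/succn_inj/code_inj[].
by move=> /code_inj-> /code_inj->.
Qed.

Lemma names_uniq q p y y' : names q p y -> names q p y' -> y = y'.
Proof.
move=> [cons_y long_y] [cons_y' _]; apply/funext => i.
have [u [v [quv up lt_i]]] := long_y i.+1.
by rewrite -(nth_initial (cons_y _ _ quv up) lt_i)
           -(nth_initial (cons_y' _ _ quv up) lt_i).
Qed.

Lemma Phi_funP q p y : Phi_fun q p = Some y <-> names q p y.
Proof.
rewrite /Phi_fun; case: pselect => [ex|nex]; last first.
  by split=> // qpy; case: nex; exists y.
case: cid => y' qpy' /=; split=> [[<-] // | qpy].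
by rewrite (names_uniq qpy' qpy).
Qed.

Lemma lists_graph_names phi q p y :
  (forall u v, lists q u v <-> v = phi u) -> names q p y <-> is_sup phi p y.
Proof.
move=> qE; split=> -[cons_y long_y]; split.
- by move=> w wp; apply: cons_y wp; apply/qE.
- by move=> m; have [u [v [/qE -> up le_m]]] := long_y m; exists u.
- by move=> u v /qE -> /cons_y.
- by move=> m; have [w wp le_m] := long_y m; exists w, (phi w); split=> //; apply/qE.
Qed.

Section Naturality.

Variable q : baire.

Definition digit_pair (d : nat) : option (word * word) :=
  if d is k.+3 then
    if CodeSeq.decode k is [:: a; b] then
      Some (CodeSeq.decode a, CodeSeq.decode b)
    else None
  else None.

Lemma digit_pairP d u v : digit_pair d = Some (u, v) <-> d = pair_digit u v.
Proof.
split=> [|->]; last by rewrite /digit_pair /pair_digit !CodeSeq.codeK.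
case: d => [|[|[|k]]] //=; case E: (CodeSeq.decode k) => [|a [|b [|]]] // [<- <-].
by rewrite /pair_digit !CodeSeq.decodeK -E CodeSeq.decodeK.
Qed.

Definition entry (w : word) (i : nat) : option word :=
  if digit_pair (q i) is Some (u, v) then
    if prefix u w then Some v else None
  else None.

Definition stage (m : nat) (w : word) : seq word := pmap (entry w) (iota 0 m).

Definition longest (s : seq word) : word :=
  foldr (fun v acc => if size acc <= size v then v else acc) [::] s.

Definition consistent (s : seq word) : bool :=
  all (fun v => prefix v (longest s)) s.

Fixpoint approx (m : nat) (w : word) : word :=
  if m is m'.+1 then
    let s := stage m (take m w) in
    if consistent s then longest s else approx m' w
  else [::].

Lemma stageP m w v : reflect
  (exists i u, [/\ i < m, q i = pair_digit u v & prefix u w]) (v \in stage m w).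
Proof.
apply: (iffP idP) => [|[i [u [lt_im /digit_pairP qi uw]]]].
  rewrite mem_pmap => /mapP[i]; rewrite mem_iota /= add0n /entry => lt_im.
  case E: (digit_pair (q i)) => [[u v']|] //.
  by case: ifP => // uw [->]; exists i, u; split=> //; apply/digit_pairP.
rewrite mem_pmap; apply/mapP; exists i; first by rewrite mem_iota.
by rewrite /entry qi uw.
Qed.

Lemma longest_mem s : longest s = [::] \/ longest s \in s.
Proof.
elim: s => [|v s IH] /=; first by left.
case: ifP => _; first by right; rewrite inE eqxx.
by case: IH => [->|IH]; [left | right; rewrite inE IH orbT].
Qed.

Lemma longest_size s v : v \in s -> size v <= size (longest s).
Proof.
elim: s => //= a s IH; rewrite inE => /predU1P[->|/IH h].
  by case: ifP => [|/negbT]; rewrite -?ltnNge => // /ltnW.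
by case: ifP => // /(leq_trans h).
Qed.

Lemma stage_sub m w v : v \in stage m (take m w) -> v \in stage m.+1 (take m.+1 w).
Proof.
move/stageP => [i [u [lt_im qi uw]]]; apply/stageP; exists i, u; split=> //.
  exact: leqW.
apply: prefix_trans uw _; rewrite -(take_takel w (leqnSn m)).
exact: prefix_take.
Qed.

Lemma consistent_sub s t : {subset s <= t} -> consistent t -> consistent s.
Proof.
move=> sub /allP ct; apply/allP => v vs.
have lt : prefix (longest s) (longest t).
  by case: (longest_mem s) => [->|/sub /ct //]; rewrite prefix0s.
exact: prefix_comparable (ct _ (sub _ vs)) lt (longest_size vs).
Qed.

Lemma approxE m w : approx m.+1 w =
  let s := stage m.+1 (take m.+1 w) in
  if consistent s then longest s else approx m w.
Proof. by []. Qed.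

Lemma approx_step m w : prefix (approx m w) (approx m.+1 w).
Proof.
rewrite [approx m.+1 w]/=; case: ifP => [c1|_]; last exact: prefix_refl.
case: m c1 => [|m] c1; first exact: prefix0s.
have sub := @stage_sub m.+1 w.
rewrite /= (consistent_sub sub c1).
case: (longest_mem (stage m.+1 (take m.+1 w))) => [->|/sub]; first exact: prefix0s.
by move/allP: c1; apply.
Qed.

Lemma approx_mono m n w : m <= n -> prefix (approx m w) (approx n w).
Proof.
elim: n => [|n IH]; first by rewrite leqn0 => /eqP->; exact: prefix_refl.
rewrite leq_eqVlt => /predU1P[->|/IH h]; first exact: prefix_refl.
exact: prefix_trans h (approx_step _ _).
Qed.

Lemma approx_take m n w : m <= n -> approx m (take n w) = approx m w.
Proof.
elim: m => // m IH lt_mn; rewrite /= take_takel // IH //; exact: ltnW.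
Qed.

Definition graph_fun (w : word) : word := approx (size w) w.

Lemma graph_fun_mono : monotone graph_fun.
Proof.
move=> u w uw; rewrite /graph_fun; have /eqP Eu : take (size u) w == u by rewrite -prefixE.
by rewrite -{2}Eu approx_take //; apply/approx_mono/size_prefix.
Qed.

Lemma graph_fun_mkseq p n : graph_fun (mkseq p n) = approx n (mkseq p n).
Proof. by rewrite /graph_fun size_mkseq. Qed.

Lemma graph_fun_sup p y : is_sup graph_fun p y <-> names q p y.
Proof.
pose S n := stage n (mkseq p n).
have approxS n : graph_fun (mkseq p n.+1) =
    if consistent (S n.+1) then longest (S n.+1) else graph_fun (mkseq p n).
  rewrite !graph_fun_mkseq approxE; cbv zeta; rewrite take_oversize ?size_mkseq //.
  case: ifP => // _; rewrite -(approx_take (mkseq p n.+1) (leqnn n)) take_mkseq ?leqnSn //.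
have subS n : {subset S n <= S n.+1}.
  move=> v; rewrite /S -(take_mkseq p (leqnSn n)) => /stage_sub.
  by rewrite take_oversize ?size_mkseq.
have subSS m n : m <= n -> {subset S m <= S n}.
  elim: n => [|n IH]; first by rewrite leqn0 => /eqP->.
  by rewrite leq_eqVlt => /predU1P[-> //|/IH h] v /h /subS.
have phiE n : consistent (S n) -> graph_fun (mkseq p n) = longest (S n).
  by case: n => // n; rewrite approxS => ->.
have listS u v : lists q u v -> initial u p -> exists n, v \in S n.
  move=> [i qi] up; exists (maxn i.+1 (size u)); apply/stageP.
  exists i, u; split=> //; first exact: leq_maxl.
  by rewrite {1}up; apply/mkseq_prefix/leq_maxr.
have Slist n v : v \in S n -> exists2 u, lists q u v & initial u p.
  move=> /stageP[i [u [_ qi un]]]; exists u; first by exists i.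
  exact: initial_prefix un (initial_mkseq _ _).
split=> -[cons_y long_y].
- have cS n : consistent (S n).
    apply: contraT => nc.
    have nc' m : n <= m -> ~~ consistent (S m).
      by move=> /subSS /consistent_sub h; apply: contra nc.
    have froz k : graph_fun (mkseq p (n + k)) = graph_fun (mkseq p n).
      elim: k => [|k IH]; first by rewrite addn0.
      by rewrite addnS approxS (negbTE (nc' _ _)) // -addnS leq_addr.
    have [w wp] := long_y (size (graph_fun (mkseq p n))).+1.
    suff /size_prefix h : prefix (graph_fun w) (graph_fun (mkseq p n)) by rewrite ltnNge h.
    rewrite -(froz (size w)) {1}wp; apply/graph_fun_mono/mkseq_prefix/leq_addl.
  split=> [u v quv up|m].
    have [n vS] := listS _ _ quv up.
    have := cons_y _ (initial_mkseq p n); rewrite phiE //.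
    by apply: initial_prefix; move/allP: (cS n); apply.
  have [w wp] := long_y m.+1; rewrite wp phiE //.
  case: (longest_mem (S (size w))) => [->//|/Slist[u quv up]] /ltnW le_m.
  by exists u, (longest (S (size w))).
- have Sy n v : v \in S n -> initial v y.
    by move=> /Slist[u quv up]; apply: cons_y quv up.
  have cS n : consistent (S n).
    apply/allP => v vS; case: (longest_mem (S n)) => [E|lS].
      by have := longest_size vS; rewrite E leqn0 => /nilP ->.
    by apply: initial_comparable (longest_size vS); apply: Sy; eassumption.
  split=> [w wp|m].
    rewrite wp phiE //.
    by case: (longest_mem (S (size w))) => [->|/Sy].
  have [u [v [quv up le_m]]] := long_y m.
  have [n vS] := listS _ _ quv up.
  exists (mkseq p n); first exact: initial_mkseq.
  by rewrite phiE // (leq_trans le_m) // longest_size.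
Qed.

Lemma Phi_natural : natural_continuous (Phi_fun q).
Proof.
exists graph_fun; first exact: graph_fun_mono.
by move=> p y; rewrite Phi_funP graph_fun_sup.
Qed.

End Naturality.

Definition Phi (q : baire) : cfun := exist _ (Phi_fun q) (@Phi_natural q).

Lemma Phi_surj (F : cfun) : exists q, Phi q = F.
Proof.
case: F => F natF; have [phi _ FE] := natF.
pose q n := pair_digit (CodeSeq.decode n) (phi (CodeSeq.decode n)).
exists q; apply: eq_exist; apply/funext => p.
have qE u v : lists q u v <-> v = phi u.
  split=> [[i /pair_digit_inj[<- <-]] // | ->].
  by exists (CodeSeq.code u); rewrite /q CodeSeq.codeK.
have E y : Phi_fun q p = Some y <-> F p = Some y.
  by rewrite Phi_funP FE; apply: lists_graph_names.
case EF: (F p) => [y|]; first exact/E.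
by case EP: (Phi_fun q p) => [y|] //; move/E: EP; rewrite EF.
Qed.

Definition U (q : baire) : pfun baire baire := sval (Phi q).

Definition computable_operation (f : pfun (cfun * baire) baire) : Prop :=
  exists2 F : pfun baire baire, computable F &
    forall s r, dom f (Phi s, r) -> F (interleave s r) = f (Phi s, r).

Definition computable_injection (F : pfun baire baire) : Prop :=
  [/\ computable F,
      forall p p', dom F p -> F p = F p' -> p = p' &
      exists2 G : pfun baire baire, computable G &
        forall p, dom F p -> obind G (F p) = Some p].

(* Main.v *)
(* Let [phi] approximate the realizer of [f].  Given a name [s] of the fixed
   point [R] itself, [R q] lists, for every word [u], the pair [(u, v)] with [v]
   the value of [phi] on the initial segment of [<s, <q, p>>] determined by
   [u], where [p] extends [u]; hence [R q] names [p |-> f (R, <q, p>)].  Since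
   [u] is no longer than the position of this pair, the first [n] digits of [R q]
   depend on the first [n] digits of [s] and [q] only.  So the graph of [R] on
   the [n]-th word can be computed from the first [n] entries of [s]: the name
   [s] is obtained by course-of-values recursion, without a recursion theorem.
   Digits that code no pair, at the odd positions of [R q], make [R] injective. *)
Require Import Defs.
From mathcomp Require Import all_boot boolp.

Set Implicit Arguments.
Unset Strict Implicit.
Unset Printing Implicit Defensive.

Import CodeSeq.

(** * Partial recursive functions on words *)

(* Environments are infinite sequences, so that weakening an expression under
   a binder is a mere shift of the environment; only the first [n] entries are
   passed to the term. *)
Definition rec_fun n (f : baire -> nat) : Prop :=
  exists c : partrec n, forall v : n.-tuple nat, rec_graph c v (f (nth 0 v)).

Definition rec_word n (f : baire -> word) : Prop :=
  rec_fun n (fun v => code (f v)).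

Definition shift k (v : baire) : baire := fun i => v (k + i).

Lemma eq_rec_fun n f g : f =1 g -> rec_fun n f -> rec_fun n g.
Proof. by move=> /funext ->. Qed.

Lemma eq_rec_word n f g : f =1 g -> rec_word n f -> rec_word n g.
Proof. by move=> /funext ->. Qed.

Lemma rec_fun_code n f : rec_word n f -> rec_fun n (fun v => code (f v)).
Proof. by []. Qed.

Lemma rec_fun_comp n F a (c : partrec 1) :
    (forall x, rec_graph c [tuple x] (F x)) ->
  rec_fun n a -> rec_fun n (fun v => F (a v)).
Proof.
move=> cF [ca caE]; exists (rec_comp c (fun=> ca)) => v /=.
by exists [tuple a (nth 0 v)] => // i; rewrite ord1 tnth0.
Qed.

Lemma rec_fun_var n i : i < n -> rec_fun n (fun v => v i).
Proof.
by move=> lt_in; exists (rec_proj (Ordinal lt_in)) => v /=; rewrite (tnth_nth 0).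
Qed.

Lemma rec_fun0 n : rec_fun n (fun=> 0).
Proof.
have h : 'I_0 -> partrec n by case.
by exists (rec_comp rec_zero h) => v /=; exists [tuple] => // -[].
Qed.

Lemma rec_funS n a : rec_fun n a -> rec_fun n (fun v => (a v).+1).
Proof. exact: (@rec_fun_comp _ S _ rec_succ). Qed.

Lemma rec_fun_iteri n g h a :
    rec_fun n g -> rec_fun n.+2 (fun v => h (v 0) (v 1) (shift 2 v)) ->
    rec_fun n a ->
  rec_fun n (fun v => iteri (a v) (fun x z => h x z v) (g v)).
Proof.
move=> [cg cgE] [ch chE] [ca caE].
pose args i := oapp (@rec_proj n) ca (unlift ord0 i).
exists (rec_comp (rec_prim cg ch) args) => v.
exists (cons_tuple (a (nth 0 v)) v).
  move=> i; rewrite /args; case: unliftP => [j|] ->; last exact: caE.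
  by rewrite /= !(tnth_nth 0).
rewrite /= -[X in rec_graph cg X]/(behead_tuple (cons_tuple _ v)).
have -> : behead_tuple (cons_tuple (a (nth 0 v)) v) = v by apply: val_inj.
rewrite /thead (tnth_nth 0) /=; elim: (a _) => [|x IH]; first exact: cgE.
by exists (iteri x (fun x z => h x z (nth 0 v)) (g (nth 0 v))) => //; apply: chE.
Qed.

(** The two conditions make [m v] the least zero of [g], which is what minimization returns. *)
Lemma rec_fun_min n g m :
    rec_fun n.+1 (fun v => g (v 0) (shift 1 v)) ->
    (forall v, g (m v) v = 0) -> (forall v x, x < m v -> 0 < g x v) ->
  rec_fun n m.
Proof.
move=> [c cE] g0 gpos; exists (rec_min c) => v; split.
  by have := cE (cons_tuple (m (nth 0 v)) v); rewrite /= -[X in _ X]/(g _ _) g0.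
move=> x /gpos; have := cE (cons_tuple x v); rewrite /= -[X in rec_graph _ _ X]/(g x (nth 0 v)).
by case: (g _ _) => // z cz _; exists z.
Qed.


Lemma rec_fun_shift k n f : rec_fun n f -> rec_fun (k + n) (fun v => f (shift k v)).
Proof.
move=> [c cE]; exists (rec_comp c (fun i => rec_proj (rshift k i))) => v.
exists [tuple tnth v (rshift k i) | i < n]; first by move=> i; rewrite tnth_mktuple.
have -> : shift k (nth 0 v) = nth 0 [tuple tnth v (rshift k i) | i < n].
  apply/funext => i; rewrite /shift; case: (ltnP i n) => [lt_in|le_ni].
    by rewrite (nth_mktuple _ _ (Ordinal lt_in)) (tnth_nth 0).
  (* Beyond the last entry both environments return the default 0. *)
  by rewrite !nth_default ?size_tuple ?leq_add2l.
exact: cE.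
Qed.

Lemma rec_fun_iter n g h a :
    rec_fun n g -> rec_fun n.+2 (fun v => h (v 1) (shift 2 v)) ->
    rec_fun n a ->
  rec_fun n (fun v => iter (a v) (h^~ v) (g v)).
Proof.
move=> rg rh ra; apply: (@eq_rec_fun _ (fun v => iteri (a v) (fun _ z => h z v) (g v))).
  by move=> v; elim: (a v) => //= x ->.
exact: rec_fun_iteri.
Qed.

(** * Elementary arithmetic and branching on parity *)

Lemma rec_fun_pred n a : rec_fun n a -> rec_fun n (fun v => (a v).-1).
Proof.
move=> ra; apply: (@eq_rec_fun _ (fun v => iteri (a v) (fun x _ => x) 0)).
  by move=> v; case: (a v).
apply: rec_fun_iteri => //; [exact: rec_fun0 | exact: rec_fun_var].
Qed.

Lemma rec_fun_double n a : rec_fun n a -> rec_fun n (fun v => (a v).*2).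
Proof.
move=> ra; apply: (@eq_rec_fun _ (fun v => iteri (a v) (fun _ z => z.+2) 0)).
  by move=> v; elim: (a v) => //= x ->.
apply: rec_fun_iteri => //; first exact: rec_fun0.
by do 2!apply: rec_funS; apply: rec_fun_var.
Qed.

Lemma rec_fun_odd n a : rec_fun n a -> rec_fun n (fun v => odd (a v)).
Proof.
(* The inner iteration sends 0 to 1 and positive numbers to 0, so each round flips the parity. *)
move=> ra; apply: (@eq_rec_fun _ (fun v => iteri (a v)
    (fun _ z => iteri z (fun _ _ => 0) 1) 0)).
  by move=> v; elim: (a v) => //= x ->; case: odd.
apply: rec_fun_iteri => //; first exact: rec_fun0.
apply: rec_fun_iteri; [|exact: rec_fun0 | exact: rec_fun_var].
by apply: rec_funS; apply: rec_fun0.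
Qed.

Lemma rec_fun_if n a f g :
    rec_fun n a -> rec_fun n f -> rec_fun n g ->
  rec_fun n (fun v => if odd (a v) then f v else g v).
Proof.
move=> /rec_fun_odd ra rf rg.
(* An iteration of length 0 keeps [g v]; one of length 1 overwrites it by [f v]. *)
apply: (@eq_rec_fun _ (fun v => iteri (odd (a v)) (fun _ _ => f v) (g v))).
  by move=> v; case: odd.
by apply: rec_fun_iteri => //; apply: (rec_fun_shift 2 rf).
Qed.

Lemma rec_fun_half n a : rec_fun n a -> rec_fun n (fun v => (a v)./2).
Proof.
move=> ra; apply: (@eq_rec_fun _ (fun v => iteri (a v)
    (fun x z => if odd x then z.+1 else z) 0)).
  by move=> v; elim: (a v) => //= x ->; rewrite uphalf_half; case: odd.
apply: rec_fun_iteri => //; first exact: rec_fun0.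
by apply: rec_fun_if; [|apply: rec_funS|]; apply: rec_fun_var.
Qed.


(** * Operations on coded words *)

(* [code (x :: w)] is [2 ^ x * (2 * code w + 1)]. *)
Lemma rec_word_cons n a f :
  rec_fun n a -> rec_word n f -> rec_word n (fun v => a v :: f v).
Proof.
move=> ra rf; apply: (@eq_rec_fun _ (fun v => iter (a v)
    (fun z => z.*2) (code (f v)).*2.+1)).
  move=> v; rewrite [RHS]/=; elim: (a v) => /= [|x ->]; first by rewrite mul1n.
  by rewrite expnS -mul2n mulnA.
apply: rec_fun_iter => //; first by apply: rec_funS; apply: rec_fun_double.
by apply: rec_fun_double; apply: rec_fun_var.
Qed.

Lemma iter_half_expn k x m : iter k half (2 ^ (k + x) * m) = 2 ^ x * m.
Proof.
by elim: k => // k IH; rewrite iterSr addSn expnS -mulnA mul2n doubleK.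
Qed.

(** The head is the exponent of 2 in the code: the least number of halvings that leaves an odd
    number. For the empty word, of code 0, the value [code (f v)] in the other branch stops the
    search at 0, the default head. *)
Lemma rec_fun_head n f : rec_word n f -> rec_fun n (fun v => head 0 (f v)).
Proof.
move=> rf; apply: (@rec_fun_min _ (fun x v =>
    if odd (iter x half (code (f v))) then 0 else code (f v))).
- apply: rec_fun_if; [|exact: rec_fun0|exact: (rec_fun_shift 1 rf)].
  apply: rec_fun_iter; [exact: (rec_fun_shift 1 rf)| |exact: rec_fun_var].
  by apply: rec_fun_half; apply: rec_fun_var.
- move=> v; case: (f v) => //= x w.
  by rewrite -{2}[x]addn0 iter_half_expn mul1n /= odd_double.
move=> v x; case: (f v) => //= y w lt_xy.
rewrite -{1}(subnKC (ltnW lt_xy)) iter_half_expn oddM oddX subn_eq0.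
by rewrite [y <= x]leqNgt lt_xy muln_gt0 expn_gt0.
Qed.

(** Halving as often as the head says removes the power of 2; one more halving turns
    [2 * code w + 1] into [code w]. *)
Lemma rec_word_behead n f : rec_word n f -> rec_word n (fun v => behead (f v)).
Proof.
move=> rf; apply: (@eq_rec_fun _ (fun v => iter (head 0 (f v)).+1 half (code (f v)))).
  move=> v; case: (f v) => //= x w.
  by rewrite -{2}[x]addn0 iter_half_expn mul1n /= uphalf_double.
apply: rec_fun_iter => //; first by apply: rec_fun_half; apply: rec_fun_var.
by apply: rec_funS; apply: rec_fun_head.
Qed.

Lemma rec_word_decode n a : rec_fun n a -> rec_word n (fun v => decode (a v)).
Proof. by apply: eq_rec_fun => v; rewrite decodeK. Qed.

Lemma rec_word_comp n phi f :
  computable_word phi -> rec_word n f -> rec_word n (fun v => phi (f v)).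
Proof.
move=> [c cE] rf.
apply: (@eq_rec_fun _ (fun v => code (phi (decode (code (f v)))))).
  by move=> v; rewrite codeK.
apply: (@rec_fun_comp _ (fun x => code (phi (decode x))) _ c) => // x.
by have := cE (decode x); rewrite decodeK.
Qed.

Lemma rec_word_iteri n g h a :
    rec_word n g -> rec_word n.+2 (fun v => h (v 0) (decode (v 1)) (shift 2 v)) ->
    rec_fun n a ->
  rec_word n (fun v => iteri (a v) (fun x w => h x w v) (g v)).
Proof.
move=> rg rh ra; apply: (@eq_rec_fun _ (fun v =>
    iteri (a v) (fun x z => code (h x (decode z) v)) (code (g v)))).
  by move=> v; elim: (a v) => //= x ->; rewrite codeK.
exact: rec_fun_iteri.
Qed.

Lemma rec_word_drop n a f :
  rec_fun n a -> rec_word n f -> rec_word n (fun v => drop (a v) (f v)).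
Proof.
move=> ra rf; apply: (@eq_rec_word _ (fun v => iteri (a v) (fun _ => behead) (f v))).
  by move=> v; elim: (a v) => /= [|x ->]; rewrite ?drop0 // -drop1 drop_drop.
apply: rec_word_iteri => //.
by apply/rec_word_behead/rec_word_decode/rec_fun_var.
Qed.

Lemma rec_fun_nth n a f :
  rec_fun n a -> rec_word n f -> rec_fun n (fun v => nth 0 (f v) (a v)).
Proof.
move=> ra rf; apply: (@eq_rec_fun _ (fun v => head 0 (drop (a v) (f v)))).
  by move=> v; rewrite -nth0 nth_drop addn0.
exact/rec_fun_head/rec_word_drop.
Qed.

(** Only the empty word has code 0, so the length is found by searching for the first [x] such that
    dropping [x] letters leaves code 0. *)
Lemma rec_fun_size n f : rec_word n f -> rec_fun n (fun v => size (f v)).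
Proof.
move=> rf; apply: (@rec_fun_min _ (fun x v => code (drop x (f v)))).
- apply: rec_fun_code.
  by apply: rec_word_drop; [exact: rec_fun_var | exact: (rec_fun_shift 1 rf)].
- by move=> v; rewrite drop_size.
move=> v x lt_x; rewrite (drop_nth 0 lt_x) /=.
by rewrite muln_gt0 expn_gt0.
Qed.

Lemma rec_word_nil n : rec_word n (fun=> [::]).
Proof. exact: rec_fun0. Qed.

(* Primitive recursion conses the last entry first, hence the reversal. *)
Lemma rec_word_rev_mkseq n h a :
    rec_fun n.+2 (fun v => h (v 0) (shift 2 v)) -> rec_fun n a ->
  rec_word n (fun v => rev (mkseq (h^~ v) (a v))).
Proof.
move=> rh ra; apply: (@eq_rec_word _ (fun v =>
    iteri (a v) (fun x w => h x v :: w) [::])).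
  by move=> v; elim: (a v) => //= x ->; rewrite mkseqS rev_rcons.
apply: rec_word_iteri => //; first exact: rec_word_nil.
by apply: rec_word_cons => //; apply/rec_word_decode/rec_fun_var.
Qed.

Lemma rec_word_rev n f : rec_word n f -> rec_word n (fun v => rev (f v)).
Proof.
move=> rf; apply: (@eq_rec_word _ (fun v => rev (mkseq (nth 0 (f v)) (size (f v))))).
  by move=> v; rewrite mkseq_nth.
apply: rec_word_rev_mkseq; last exact: rec_fun_size.
by apply: rec_fun_nth; [exact: rec_fun_var | exact: (rec_fun_shift 2 rf)].
Qed.

Lemma rec_word_mkseq n h a :
    rec_fun n.+2 (fun v => h (v 0) (shift 2 v)) -> rec_fun n a ->
  rec_word n (fun v => mkseq (h^~ v) (a v)).
Proof.
move=> rh ra; apply: (@eq_rec_word _ (fun v => rev (rev (mkseq (h^~ v) (a v))))).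
  by move=> v; rewrite revK.
by apply: rec_word_rev; apply: rec_word_rev_mkseq.
Qed.

Lemma rec_word_rcons n f a :
  rec_word n f -> rec_fun n a -> rec_word n (fun v => rcons (f v) (a v)).
Proof.
move=> rf ra; apply: (@eq_rec_word _ (fun v => rev (a v :: rev (f v)))).
  by move=> v; rewrite rev_cons revK.
by apply: rec_word_rev; apply: rec_word_cons => //; apply: rec_word_rev.
Qed.

Lemma rec_fun_pair_digit n f g :
  rec_word n f -> rec_word n g -> rec_fun n (fun v => pair_digit (f v) (g v)).
Proof.
move=> rf rg; do 3!apply: rec_funS; apply: rec_fun_code.
apply: rec_word_cons; first exact: rec_fun_code.
by apply: rec_word_cons; [exact: rec_fun_code | exact: rec_word_nil].
Qed.

Lemma computable_word_rec phi :
  rec_word 1 (fun v => phi (decode (v 0))) -> computable_word phi.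
Proof.
move=> [c cE]; exists c => w; have := cE [tuple code w].
by rewrite /= codeK.
Qed.

(** * Functions with a modulus of continuity *)

Lemma eq_in_mkseq (p q : baire) n :
  (forall i, i < n -> p i = q i) -> mkseq p n = mkseq q n.
Proof.
by move=> pq; apply/eq_in_map => i; rewrite mem_iota => /pq.
Qed.

Lemma sup_uniq phi p y y' : is_sup phi p y -> is_sup phi p y' -> y = y'.
Proof.
move=> [phi_y long] [phi_y' _]; apply/funext => i.
have [w wp lt_i] := long i.+1.
by rewrite -(nth_initial (phi_y _ wp) lt_i) (nth_initial (phi_y' _ wp) lt_i).
Qed.

Section Modulus.

Variables (L : baire -> baire) (modulus : nat -> nat) (psi : word -> word).
Hypothesis modulus_mono : {homo modulus : m n / m <= n}.
Hypothesis modulus_inf : forall m, exists n, m <= modulus n.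
Hypothesis psiE : forall p n, psi (mkseq p n) = mkseq (L p) (modulus n).

(** A word is an initial segment of its own extension by zeros, so [psiE] governs [psi] on every
    word. *)
Lemma modulus_monotone : monotone psi.
Proof.
move=> u v uv; have le_uv := size_prefix uv.
have -> : u = mkseq (nth 0 v) (size u).
  by move: uv; rewrite prefixE -{1}[v](mkseq_nth 0) take_mkseq // => /eqP.
by rewrite -{2}[v](mkseq_nth 0) !psiE; apply/mkseq_prefix/modulus_mono.
Qed.

Lemma modulus_sup p : is_sup psi p (L p).
Proof.
split=> [w ->|m]; first by rewrite psiE; apply: initial_mkseq.
have [n le_mn] := modulus_inf m.
by exists (mkseq p n); rewrite ?psiE ?size_mkseq //; apply: initial_mkseq.
Qed.

Lemma modulus_natural : natural_continuous (total_pfun L).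
Proof.
exists psi => [|p y]; first exact: modulus_monotone.
split=> [[<-]|psi_y]; first exact: modulus_sup.
congr Some; apply: sup_uniq psi_y; exact: modulus_sup.
Qed.

Lemma modulus_computable :
  computable_word psi -> computable (total_pfun L).
Proof.
move=> cpsi; exists psi; split=> //; first exact: modulus_monotone.
by move=> p _ [<-]; apply: modulus_sup.
Qed.

End Modulus.

(** * The fixed point *)

Section FixedPoint.

Variable phi : word -> word.

(* [query s q u] has twice the length of [u] and so reads [s], [q] and [u] only
   below [size u]. *)
Definition query (s q : baire) (u : word) : word :=
  mkseq (interleave s (interleave q (nth 0 u))) (size u).*2.

(* The digit of the code of a one-letter word codes no pair. *)
Definition reply (s q : baire) : baire := fun i =>
  if odd i then (code [:: q i./2]).+3
  else pair_digit (decode i./2) (phi (query s q (decode i./2))).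

(** The word is padded with zeros; the digits kept do not depend on the padding. *)
Definition reply_word (s : baire) (w : word) : word :=
  mkseq (reply s (nth 0 w)) (size w).

(** Entry [m] reads the name only below [size (decode m) <= m], so the word built so far can stand
    in for the name. *)
Definition self_word (n : nat) : word :=
  iteri n (fun m w => rcons w (pair_digit (decode m) (reply_word (nth 0 w) (decode m))))
        [::].

Definition self : baire := fun n => nth 0 (self_word n.+1) n.

Lemma size_decode n : size (decode n) <= n.
Proof.
suff: size (decode n) <= code (decode n) by rewrite decodeK.
elim: (decode n) => //= x w IH; apply: leq_trans (_ : (code w).*2.+1 <= _).
  by rewrite ltnS (leq_trans IH) // -addnn leq_addl.
by rewrite leq_pmull // expn_gt0.
Qed.

Lemma self_wordE n : self_word n = mkseq self n.
Proof.
have sz m : size (self_word m) = m by elim: m => //= m IH; rewrite size_rcons IH.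
elim: n => // n IH; rewrite mkseqS -IH {1}/self_word /= -/(self_word n).
by rewrite /self /= nth_rcons sz ltnn eqxx.
Qed.

(** Interleaving halves a position at least once, so positions below twice [size u] lead to reads
    below [size u]. *)
Lemma eq_query s s' q q' u u' :
    (forall i, i < size u -> s i = s' i) -> (forall i, i < size u -> q i = q' i) ->
    (forall i, i < size u -> nth 0 u i = u' i) ->
  query s q u = mkseq (interleave s' (interleave q' u')) (size u).*2.
Proof.
move=> es eq eu; apply: eq_in_mkseq => i lt_i.
have lt_i2 : i./2 < size u by rewrite ltn_half_double.
have lt_i4 : i./2./2 < size u.
  by apply: leq_ltn_trans lt_i2; rewrite leq_half_double leqW // -addnn leq_addr.
rewrite /interleave; case: odd; last exact: es.
by case: odd; [exact: eu | exact: eq].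
Qed.

(** Digit [i] reads [q] at [i./2] or queries with [decode i./2], whose length is at most [i./2]. *)
Lemma eq_reply s s' q q' n :
    (forall i, i < n -> s i = s' i) -> (forall i, i < n -> q i = q' i) ->
  forall i, i < n -> reply s q i = reply s' q' i.
Proof.
move=> es eq i lt_in.
have lt_n : i./2 < n.
  by apply: leq_ltn_trans lt_in; rewrite leq_half_double leqW // -addnn leq_addr.
have sub j : j < size (decode i./2) -> j < n.
  by move=> /leq_trans -> //; apply: leq_trans (size_decode _) (ltnW lt_n).
rewrite /reply eq //; case: odd => //; congr (pair_digit _ (phi _)).
by apply: eq_query => // j /sub; [exact: es | exact: eq].
Qed.

Lemma reply_word_self n w :
  size w <= n -> reply_word (nth 0 (self_word n)) w = reply_word self w.
Proof.
move=> le_wn; apply/eq_in_mkseq/eq_reply => // i lt_i.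
by rewrite self_wordE nth_mkseq // (leq_trans lt_i).
Qed.

(** The fixed-point equation: the first [n] digits suffice for the word [decode n], so the finite
    stage may be replaced by the whole name. *)
Lemma selfE n : self n = pair_digit (decode n) (reply_word self (decode n)).
Proof.
rewrite -(reply_word_self (size_decode n)) {1}/self self_wordE mkseqS -self_wordE.
have sz : size (self_word n) = n by rewrite self_wordE size_mkseq.
by rewrite nth_rcons sz ltnn eqxx /self /= nth_rcons sz ltnn eqxx.
Qed.

Lemma reply_word_mkseq s p n : reply_word s (mkseq p n) = mkseq (reply s p) n.
Proof.
rewrite /reply_word size_mkseq; apply/eq_in_mkseq/eq_reply => // i lt_i.
by rewrite nth_mkseq.
Qed.

Definition fix_fun : baire -> baire := reply self.

Lemma fix_natural : natural_continuous (total_pfun fix_fun).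
Proof.
apply: (@modulus_natural _ id (reply_word self)) => // [m|p n]; first by exists m.
exact: reply_word_mkseq.
Qed.

(** Closes the circle: [self] lists the graph of [reply_word self], which approximates
    [reply self]. *)
Lemma Phi_self : Phi self = exist _ (total_pfun fix_fun) fix_natural.
Proof.
apply: eq_exist; apply/funext => q; apply/Phi_funP.
apply/(@lists_graph_names (reply_word self)).
  move=> u v; split=> [[i]|->]; last by exists (code u); rewrite selfE codeK.
  by rewrite selfE => /pair_digit_inj[<- <-].
apply: (@modulus_sup _ id) => [m|p n]; first by exists m.
exact: reply_word_mkseq.
Qed.

(** Along [p] every query is an initial segment of the interleaved input, so the listed answers are
    initial segments of [y]. *)
Lemma names_fix q p y : monotone phi ->
  is_sup phi (interleave self (interleave q p)) y -> names (fix_fun q) p y.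
Proof.
set x := interleave _ _ => mono_phi [phi_y long].
have queryE u : initial u p -> query self q u = mkseq x (size u).*2.
  by move=> up; apply: eq_query => // i; apply: nth_initial.
split=> [u v [i]|m].
  rewrite /fix_fun /reply; case: odd.
    (* Odd digits code words of length 1, pair digits words of length 2. *)
    by move=> /succn_inj/succn_inj/succn_inj/(can_inj codeK).
  move=> /pair_digit_inj[-> <-] up.
  by rewrite queryE //; apply/phi_y/initial_mkseq.
(* A segment [u] as long as [w] is enough: its query has twice that length, hence extends [w]. *)
have [w wx le_m] := long m; pose u := mkseq p (size w).
have up : initial u p by apply: initial_mkseq.
exists u, (phi (query self q u)); split=> //.
  by exists (code u).*2; rewrite /fix_fun /reply odd_double doubleK codeK.
apply: leq_trans le_m _; apply/size_prefix/mono_phi.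
by rewrite queryE // {1}wx size_mkseq; apply: mkseq_prefix; rewrite -addnn leq_addl.
Qed.

(** * Computability of the fixed point *)

Lemma rec_fun_reply n s q a :
    computable_word phi -> rec_word n s -> rec_word n q -> rec_fun n a ->
  rec_fun n (fun v => reply (nth 0 (s v)) (nth 0 (q v)) (a v)).
Proof.
move=> cphi rs rq ra; have ra2 := rec_fun_half ra.
have ru := rec_word_decode ra2.
apply: rec_fun_if => //.
  do 3!apply: rec_funS; apply: rec_fun_code.
  by apply: rec_word_cons; [exact: rec_fun_nth | exact: rec_word_nil].
apply: rec_fun_pair_digit => //; apply: rec_word_comp => //.
apply: rec_word_mkseq; last by apply: rec_fun_double; apply: rec_fun_size.
(* Variable 0 is the position in the query; halved once it locates the read of [s], halved twice
   those of [q] and [u]. *)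
have r0 : rec_fun n.+2 (fun v => v 0) by apply: rec_fun_var.
have half_r0 := rec_fun_half r0.
have half2_r0 := rec_fun_half half_r0.
apply: rec_fun_if => //; last first.
  by apply: rec_fun_nth => //; apply: (rec_fun_shift 2 rs).
apply: rec_fun_if => //; last first.
  by apply: rec_fun_nth => //; apply: (rec_fun_shift 2 rq).
by apply: rec_fun_nth => //; apply: (rec_fun_shift 2 ru).
Qed.

Lemma rec_word_reply n s w :
    computable_word phi -> rec_word n s -> rec_word n w ->
  rec_word n (fun v => reply_word (nth 0 (s v)) (w v)).
Proof.
move=> cphi rs rw; apply: rec_word_mkseq; last exact: rec_fun_size.
apply: rec_fun_reply => //; last exact: rec_fun_var.
  exact: (rec_fun_shift 2 rs).
exact: (rec_fun_shift 2 rw).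
Qed.

Lemma computable_fix : computable_word phi -> computable (total_pfun fix_fun).
Proof.
move=> cphi; apply: (@modulus_computable _ id (reply_word self)) => // [m|p n|].
- by exists m.
- exact: reply_word_mkseq.
apply: computable_word_rec.
have rw : rec_word 1 (fun v => decode (v 0)) by apply/rec_word_decode/rec_fun_var.
(* The infinite name is cut to the length of the input word, and this prefix is obtained by
   recursion. *)
apply: (@eq_rec_word _ (fun v =>
    reply_word (nth 0 (self_word (size (decode (v 0))))) (decode (v 0)))).
  by move=> v; apply: reply_word_self.
apply: rec_word_reply => //; apply: rec_word_iteri; last exact: rec_fun_size.
  exact: rec_word_nil.
(* Variable 0 is the counter, read as a coded word; variable 1 codes the part of the name built so
   far. *)
have r0 : rec_word 3 (fun v => decode (v 0)) by apply/rec_word_decode/rec_fun_var.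
have r1 : rec_word 3 (fun v => decode (v 1)) by apply/rec_word_decode/rec_fun_var.
by apply: rec_word_rcons => //; apply: rec_fun_pair_digit => //; apply: rec_word_reply.
Qed.

End FixedPoint.

(** * Computable left inverse and conclusion *)

Definition unreply (p : baire) : baire := fun i =>
  head 0 (decode (p i.*2.+1).-1.-1.-1).

Lemma fix_funK phi : cancel (fix_fun phi) unreply.
Proof.
move=> q; apply/funext => i.
rewrite /unreply /fix_fun /reply oddS odd_double -[i.*2.+1./2]/(uphalf i.*2).
by rewrite uphalf_double !succnK codeK.
Qed.

(** Letter [i] is stored in digit [2 * i + 1], so [n] input digits determine the first [n./2]
    letters. *)
Lemma computable_unreply : computable (total_pfun unreply).
Proof.
apply: (@modulus_computable _ half
  (fun w => mkseq (unreply (nth 0 w)) (size w)./2)).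
- exact: half_leq.
- by move=> m; exists m.*2; rewrite doubleK.
- move=> p n; rewrite size_mkseq; apply: eq_in_mkseq => i lt_i.
  by rewrite /unreply nth_mkseq // -gtn_half_double.
apply: computable_word_rec.
have rw : rec_word 1 (fun v => decode (v 0)) by apply/rec_word_decode/rec_fun_var.
apply: rec_word_mkseq; last by apply: rec_fun_half; apply: rec_fun_size.
apply/rec_fun_head/rec_word_decode; do 3!apply: rec_fun_pred.
apply: rec_fun_nth; last exact: (rec_fun_shift 2 rw).
by apply/rec_funS/rec_fun_double/rec_fun_var.
Qed.

Theorem theorem6 (f : pfun (cfun * baire) baire) (hf : computable_operation f) :
  exists (R : baire -> baire) (natR : natural_continuous (total_pfun R)),
    computable_injection (total_pfun R) /\
    forall q p : baire,
      dom f (exist _ (total_pfun R) natR, interleave q p) ->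
      U (R q) p = f (exist _ (total_pfun R) natR, interleave q p).
Proof.
have [F [phi [cphi mono_phi FE]] Ff] := hf.
exists (fix_fun phi), (fix_natural phi); split.
  split; first exact: computable_fix.
    by move=> p p' _ [] /(can_inj (fix_funK phi)).
  exists (total_pfun unreply); first exact: computable_unreply.
  by move=> p _ /=; rewrite /total_pfun fix_funK.
(* Writing the fixed point as [Phi self] lets the realizer [F] be applied with [self] as the
   name. *)
move=> q p; rewrite -Phi_self => fR; rewrite -(Ff _ _ fR).
have [y fy] := fR; rewrite Ff // fy; apply/Phi_funP/names_fix => //.
by apply: FE; rewrite Ff.
Qed.
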